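(* Let $Q_\infty=(q_0,q_1,\dots,q_i,\dots)$ be a stochastic vector (all $q_i>0$, $\sum_{i=0}^\infty q_i=1$). If there exist constants $m_0>1$, $A>0$ and $B>0$ such that $$\frac{A}{i^{m_0}}\le q_i\le\frac{B}{i^{m_0}}\quad\text{for all } i\in\mathbb{N},$$ then the family $\Phi(Q_\infty)$ of all cylinders of the $Q_\infty$-expansion is non-faithful for the Hausdorff dimension calculation, i.e. there exists $E\subseteq[0,1)$ with $\dim_H(E,\Phi(Q_\infty))\ne\dim_H(E)$.
   Context: $\mathbb{N}_0=\{0,1,2,\dots\}$, $\mathbb{N}=\{1,2,\dots\}$. Let $Q_\infty=(q_0,q_1,\dots)$ be a stochastic vector with all $q_i>0$ and $\sum_{i=0}^\infty q_i=1$. Cylinders. Decompose $[0,1)$ from left to right into consecutive disjoint half-open intervals $\Delta_{\alpha_1}$, $\alpha_1\in\mathbb{N}_0$, of length $q_{\alpha_1}$; that is, $\Delta_i=[\sum_{j<i}q_j,\ \sum_{j\le i}q_j)$. Inductively, for $n\ge 2$, decompose each $\Delta_{\alpha_1\dots\alpha_{n-1}}$ from left to right into consecutive disjoint half-open intervals $\Delta_{\alpha_1\dots\alpha_n}$, $\alpha_n\in\mathbb{N}_0$, (closed on the left, open on the right) of length $q_{\alpha_1}q_{\alpha_2}\cdots q_{\alpha_n}$. The intervals $\Delta_{\alpha_1\dots\alpha_n}$ are the cylinders of rank $n$ of the $Q_\infty$-expansion, and $\Phi(Q_\infty)=\{\Delta_{\alpha_1\dots\alpha_n}: n\in\mathbb{N},\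 \alpha_1,\dots,\alpha_n\in\mathbb{N}_0\}$. Hausdorff dimension with respect to a family. For a family $\Phi$ of subsets and a set $E$, put $$H^\alpha(E,\Phi)=\lim_{\epsilon\to0}\ \inf\sum_j|E_j|^\alpha,$$ where the infimum is over all at most countable coverings $\{E_j\}$ of $E$ with $E_j\in\Phi$ and diameters $|E_j|\le\epsilon$; and $\dim_H(E,\Phi)=\inf\{\alpha: H^\alpha(E,\Phi)=0\}$. $\dim_H(E)$ denotes the classical Hausdorff dimension. *)

(* Defs.v *)
From mathcomp Require Import all_boot all_order all_algebra.
From mathcomp Require Import all_classical all_reals all_analysis.
Set Implicit Arguments.
Unset Strict Implicit.
Unset Printing Implicit Defensive.
Import Order.TTheory GRing.Theory Num.Theory.
Import numFieldNormedType.Exports.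
Local Open Scope classical_set_scope.
Local Open Scope ring_scope.

Definition stochastic_vector (R : realType) (q : nat -> R) : Prop :=
  (forall i, 0 < q i) /\ series q @ \oo --> (1 : R).

(* Cut [a, a + l) from left to right into consecutive half-open intervals of
   lengths l * q 0, l * q 1, ...; keep the one numbered by the head of s and
   continue inside it with the tail of s. *)
Fixpoint subcylinder (R : realType) (q : nat -> R) (a l : R) (s : seq nat) :
    set R :=
  if s is k :: s' then
    subcylinder q (a + l * \sum_(0 <= j < k) q j) (l * q k) s'
  else [set x | a <= x < a + l].

Definition cylinder (R : realType) (q : nat -> R) (s : seq nat) : set R :=
  subcylinder q 0 1 s.

(* The rank is at least 1, hence the exclusion of the empty sequence. *)
Definition cylinders (R : realType) (q : nat -> R) : set (set R) :=
  [set D | exists2 s : seq nat, s != [::] & D = cylinder q s].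

(* The added 0 makes the diameter of the empty set 0 rather than -oo. *)
Definition diam (R : realType) (F : set R) : \bar R :=
  ereal_sup (0%E |` [set `|x - y|%:E | x in F & y in F]).

(* An at most countable covering is a family (C j) indexed by a set J of natural
   numbers; J may be finite, so that coverings by finitely many members of a
   family which does not contain the empty set are allowed. *)
Definition eps_covering (R : realType) (Phi : set (set R)) (E : set R)
    (eps : R) (J : set nat) (C : nat -> set R) : Prop :=
  [/\ forall j, J j -> Phi (C j),
      forall j, J j -> (diam (C j) <= eps%:E)%E
    & E `<=` \bigcup_(j in J) C j].

Definition hausdorff_premeasure (R : realType) (Phi : set (set R)) (a : R)
    (E : set R) (eps : R) : \bar R :=
  ereal_inf [set v | exists (J : set nat) (C : nat -> set R),
    eps_covering Phi E eps J C /\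
    v = (\esum_(j in J) poweR (diam (C j)) a)%E].

Definition hausdorff_measure (R : realType) (Phi : set (set R)) (a : R)
    (E : set R) : \bar R :=
  lim (hausdorff_premeasure Phi a E eps @[eps --> 0^'+]).

Definition hausdorff_dim_wrt (R : realType) (E : set R) (Phi : set (set R)) :
    \bar R :=
  ereal_inf [set a%:E | a in
    [set a : R | 0 <= a /\ hausdorff_measure Phi a E = 0%E]].

(* The classical dimension allows coverings by arbitrary sets. *)
Definition hausdorff_dim (R : realType) (E : set R) : \bar R :=
  hausdorff_dim_wrt E [set: set R].

(* Main.v *)
Require Import Defs.
From mathcomp Require Import all_boot all_order all_algebra.
From mathcomp Require Import all_classical all_reals all_analysis.
From mathcomp Require Import lra.
Import Order.TTheory GRing.Theory Num.Theory.
Import numFieldNormedType.Exports.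
Local Open Scope classical_set_scope.
Local Open Scope ring_scope.

(** The witness is the set of points whose n-th digit lies in [N n, 2 N n), where
    N n is chosen recursively and grows very fast. All the children of a cylinder s
    with digits at least N n lie in an interval of length |s| (q_(N n) + ...), and
    there are only N 0 ... N (n-1) admissible words s of length n; so intervals
    cover the set cheaply once the tail of q at N n is small compared with this
    number, and the Hausdorff dimension is as small as we like.

    A cylinder, however, contains at most one child of s or all of them. Since
    q_k >= A / k^m0, an admissible cylinder of rank n has length at least
    (N 0 ... N (n-1))^(-2 m0), so for exponents up to 1 / (2 m0) it costs at least
    its share 1 / (N 0 ... N (n-1)) of the uniform mass. If a covering by
    cylinders costs less than 1, some child always keeps less than its share of
    the cost; following such children yields an uncovered point. The dimension
    with respect to cylinders is therefore at least 1 / (2 m0). *)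

(** * Hausdorff measure and dimension with respect to a family *)

Section HausdorffMeasure.
Context {R : realType}.
Implicit Types (Phi : set (set R)) (E F : set R) (a b l eps : R).

Lemma diam_ge0 F : (0 <= diam F)%E.
Proof. by apply: ereal_sup_ubound; left. Qed.

Lemma diam_le F l : 0 <= l -> (forall x y, F x -> F y -> `|x - y| <= l) ->
  (diam F <= l%:E)%E.
Proof.
move=> l0 Fl; apply: ge_ereal_sup => _ [->|[x Fx [y Fy <-]]].
  by rewrite lee_fin.
by rewrite lee_fin Fl.
Qed.

Lemma diam_itvco_le b l : 0 <= l -> (diam [set x : R | (b <= x < b + l)%R] <= l%:E)%E.
Proof.
move=> l0; apply: diam_le => // x y /= /andP[bx xl] /andP[yb yl].
by rewrite ler_norml; apply/andP; split; lra.
Qed.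

Lemma diam_itvco_ge b l : 0 < l -> (l%:E <= diam [set x : R | (b <= x < b + l)%R])%E.
Proof.
move=> l0; set D := diam _.
have D0 : (0 <= D)%E := diam_ge0 _.
have Dfin : D \is a fin_num.
  by rewrite ge0_fin_numE//; apply: le_lt_trans (diam_itvco_le b l (ltW l0)) (ltry _).
rewrite leNgt; apply/negP; rewrite -(fineK Dfin) lte_fin => Dl.
have d0 : 0 <= fine D by apply: fine_ge0.
(* The supremum [l] is not attained, so [D < l] is refuted by two points at the intermediate
   distance [(D + l) / 2]. *)
have : (((fine D + l) / 2)%:E <= D)%E.
  apply: ereal_sup_ubound; right.
  exists (b + (fine D + l) / 2) => /=; first by lra.
  exists b => /=; first by lra.
  by rewrite addrAC subrr add0r ger0_norm//; lra.
by rewrite -{2}(fineK Dfin) lee_fin; lra.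
Qed.

Lemma premeasure_nonincreasing Phi a E (e1 e2 : R) : e1 <= e2 ->
  (hausdorff_premeasure Phi a E e2 <= hausdorff_premeasure Phi a E e1)%E.
Proof.
move=> e12; apply: ereal_inf_le_tmp => v [J [C [[PhiC dC EC] ->]]].
exists J, C; split=> //; split=> // j Jj.
by apply: le_trans (dC j Jj) _; rewrite lee_fin.
Qed.

Lemma premeasure_cvg Phi a E :
  cvg (hausdorff_premeasure Phi a E eps @[eps --> 0^'+]).
Proof.
apply/cvg_ex; eexists; apply: (nonincreasing_at_right_cvge (BInfty _ false)) => //.
by move=> x y _ _; exact: premeasure_nonincreasing.
Qed.

Lemma hausdorff_measure_ge Phi a E (c : \bar R) :
  (forall eps, 0 < eps -> (c <= hausdorff_premeasure Phi a E eps)%E) ->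
  (c <= hausdorff_measure Phi a E)%E.
Proof.
move=> cE; apply: lime_ge; first exact: premeasure_cvg.
by near=> e; apply: cE; near: e; exact: nbhs_right_gt.
Unshelve. all: by end_near. Qed.

(** Shrinking the scale only raises the premeasure, so its value at [eps] is at most that at
    [Num.min e eps], hence at most every [e > 0]. *)
Lemma hausdorff_measure_eq0 Phi a E :
  (forall eps, 0 < eps -> (hausdorff_premeasure Phi a E eps <= eps%:E)%E) ->
  hausdorff_measure Phi a E = 0%E.
Proof.
move=> Ee.
have premeasure_ge0 eps : (0 <= hausdorff_premeasure Phi a E eps)%E.
  apply/ereal_infP => _ [J [C [_ ->]]].
  by apply: esum_ge0 => j _; exact: poweR_ge0.
have premeasure_eq0 eps : 0 < eps -> hausdorff_premeasure Phi a E eps = 0%E.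
  move=> eps0; apply/eqP; rewrite eq_le premeasure_ge0 andbT.
  apply/lee_addgt0Pr => e e0; rewrite add0e.
  have m0 : 0 < Num.min e eps by rewrite lt_min e0.
  apply: le_trans (premeasure_nonincreasing _ _ _ (Num.min e eps) _ _) _.
    by rewrite ge_min lexx orbT.
  by apply: le_trans (Ee _ m0) _; rewrite lee_fin ge_min lexx.
apply: cvg_lim => //; apply: cvg_near_cst.
by near=> e; apply/premeasure_eq0; near: e; exact: nbhs_right_gt.
Unshelve. all: by end_near. Qed.

Lemma hausdorff_dim_wrt_le Phi E a : 0 <= a -> hausdorff_measure Phi a E = 0%E ->
  (hausdorff_dim_wrt E Phi <= a%:E)%E.
Proof. by move=> a0 Ea; apply: ereal_inf_lbound; exists a. Qed.

Lemma hausdorff_dim_wrt_ge Phi E a :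
  (forall b, 0 <= b -> b <= a -> (0 < hausdorff_measure Phi b E)%E) ->
  (a%:E <= hausdorff_dim_wrt E Phi)%E.
Proof.
move=> Eb; apply/ereal_infP => _ [b [b0 Hb0] <-]; rewrite lee_fin.
by rewrite leNgt; apply/negP => /ltW/(Eb b b0); rewrite Hb0 ltxx.
Qed.

End HausdorffMeasure.

(** * Geometry of the cylinders *)

Section Cylinders.
Context {R : realType} (q : nat -> R).
Hypothesis hq : stochastic_vector q.
Implicit Types (a l x : R) (s t : seq nat) (k n : nat).

Let q_gt0 k : 0 < q k. Proof. exact: hq.1. Qed.

Lemma series_lt1 k : series q k < 1.
Proof.
have homo : {homo series q : m n / (m <= n)%N >-> m <= n}.
  by apply: nondecreasing_series => i _ _; exact: ltW.
have := @nondecreasing_cvgn_le _ _ homo (cvgP _ hq.2) k.+1.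
by rewrite (cvg_lim _ hq.2)// seriesSr; have := q_gt0 k; lra.
Qed.

Lemma series_ge0 k : 0 <= series q k.
Proof. by apply: sumr_ge0 => i _; exact: ltW. Qed.

Lemma q_lt1 k : q k < 1.
Proof. by have := series_lt1 k.+1; have := series_ge0 k; rewrite seriesSr; lra. Qed.

Fixpoint subcylinder_left a l s : R :=
  if s is k :: s' then subcylinder_left (a + l * series q k) (l * q k) s' else a.

Definition cylinder_left s := subcylinder_left 0 1 s.

Definition cylinder_length s := \prod_(k <- s) q k.

Lemma subcylinderE a l s : subcylinder q a l s =
  [set x | subcylinder_left a l s <= x < subcylinder_left a l s + l * cylinder_length s].
Proof.
rewrite /cylinder_length; elim: s a l => [|k s IH] a l /=; first by rewrite big_nil mulr1.
by rewrite IH big_cons mulrA.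
Qed.

Lemma cylinderE s : cylinder q s =
  [set x | cylinder_left s <= x < cylinder_left s + cylinder_length s].
Proof. by rewrite /cylinder subcylinderE mul1r. Qed.

Lemma cylinder_left_rcons s k :
  cylinder_left (rcons s k) = cylinder_left s + cylinder_length s * series q k.
Proof.
suff left_rcons a l : subcylinder_left a l (rcons s k) =
    subcylinder_left a l s + l * cylinder_length s * series q k.
  by rewrite /cylinder_left left_rcons mul1r.
rewrite /cylinder_length; elim: s a l => [|j s IH] a l /=.
  by rewrite big_nil mulr1.
by rewrite IH big_cons mulrA.
Qed.

Lemma cylinder_length_rcons s k :
  cylinder_length (rcons s k) = cylinder_length s * q k.
Proof. by rewrite /cylinder_length -cats1 big_cat big_seq1. Qed.

Lemma cylinder_length_gt0 s : 0 < cylinder_length s.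
Proof. by apply: prodr_gt0 => k _. Qed.

Lemma cylinder_length_le1 s : cylinder_length s <= 1.
Proof. by apply: prodr_ile1 => k _; rewrite !ltW//= q_lt1. Qed.

Lemma diam_cylinder_ge s : ((cylinder_length s)%:E <= diam (cylinder q s))%E.
Proof. by rewrite cylinderE diam_itvco_ge// cylinder_length_gt0. Qed.

Lemma subcylinder_sub a l s x : 0 <= l -> subcylinder q a l s x -> a <= x < a + l.
Proof.
elim: s a l => [|k s IH] a l l0 //=; rewrite -[\sum_(_ <= _ < _) _]/(series q k).
move=> /(IH _ _ (mulr_ge0 l0 (ltW (q_gt0 k)))).
have lS0 := mulr_ge0 l0 (series_ge0 k).
have := ler_wpM2l l0 (ltW (series_lt1 k.+1)); rewrite seriesSr mulr1 mulrDr.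
by move=> lS1 /andP[? ?]; apply/andP; split; lra.
Qed.

(** Cylinders are nested or disjoint: if the first digits were [i < i'], the interval of [i] would
    end at or before the start of that of [i']. The induction is over general [a] and [l], which
    change at each digit. *)
Lemma cylinder_prefix s t x : (size s <= size t)%N ->
  cylinder q s x -> cylinder q t x -> prefix s t.
Proof.
suff prefix_sub a l : 0 < l -> (size s <= size t)%N ->
    subcylinder q a l s x -> subcylinder q a l t x -> prefix s t.
  exact: prefix_sub ltr01.
elim: s t a l => [|j s IH] [|k t] // a l l0 /= st xs xt.
have lq i : 0 < l * q i by rewrite mulr_gt0.
have itv i u : subcylinder q (a + l * series q i) (l * q i) u x ->
    a + l * series q i <= x < a + l * series q i.+1.
  by move=> /(subcylinder_sub _ _ _ _ (ltW (lq i))); rewrite seriesSr mulrDr addrA.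
have lt_false i i' u u' : subcylinder q (a + l * series q i) (l * q i) u x ->
    subcylinder q (a + l * series q i') (l * q i') u' x -> (i < i')%N -> False.
  move=> /itv/andP[_ xi] /itv/andP[xi' _] ii'.
  have : series q i.+1 <= series q i'.
    by apply: nondecreasing_series ii' => m _ _; exact: ltW.
  by rewrite -(ler_pM2l l0); lra.
case: (ltngtP j k) => [jk|kj|jk]; first by case: (lt_false _ _ _ _ xs xt jk).
  by case: (lt_false _ _ _ _ xt xs kj).
by rewrite -{}jk in xt *; apply: IH (lq j) st xs xt.
Qed.

(* The left endpoints of the nested cylinders increase and their right endpoints
   strictly decrease, so the supremum of the left endpoints lies in all of them
   although they are not closed. *)
Lemma bigcap_cylinder_neq0 (w : nat -> nat) :
  exists x, forall n, cylinder q (mkseq w n) x.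
Proof.
pose u n := cylinder_left (mkseq w n).
pose v n := u n + cylinder_length (mkseq w n).
have uS n : u n <= u n.+1.
  rewrite /u mkseqS cylinder_left_rcons lerDl mulr_ge0 ?series_ge0//.
  exact/ltW/cylinder_length_gt0.
have vS n : v n.+1 < v n.
  rewrite /v /u mkseqS cylinder_left_rcons cylinder_length_rcons -addrA -mulrDr.
  rewrite ltrD2l gtr_pMr ?cylinder_length_gt0//.
  by have := series_lt1 (w n).+1; rewrite seriesSr.
have uv n : u n < v n by rewrite ltrDl cylinder_length_gt0.
have u_homo : {homo u : m n / (m <= n)%N >-> m <= n} by apply/nondecreasing_seqP.
have v_homo : {homo v : m n / (m <= n)%N >-> m >= n}.
  by apply/nonincreasing_seqP => n; exact/ltW.
have ub_v n : ubound (range u) (v n).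
  move=> _ [m _ <-]; apply: le_trans (u_homo _ _ (leq_maxl m n)) _.
  by apply: le_trans (ltW (uv _)) (v_homo _ _ (leq_maxr m n)).
exists (sup (range u)) => n; rewrite cylinderE /=; apply/andP; split.
  by apply: ub_le_sup; [exists (v 0%N) | exists n].
by apply: le_lt_trans (vS n); apply: ge_sup => //; exists (u 0%N), 0%N.
Qed.

End Cylinders.

(** * Admissible words and the set of points they define *)

Fixpoint words (N : nat -> nat) (n : nat) : seq (seq nat) :=
  if n is m.+1 then [seq rcons s k | s <- words N m, k <- iota (N m) (N m)]
  else [:: [::]].

Section DigitBlocks.
Context {R : realType} (q : nat -> R) (N : nat -> nat).
Hypotheses (hq : stochastic_vector q) (N_gt0 : forall n, (0 < N n)%N).
Implicit Types (a x : R) (s p : seq nat) (w : nat -> nat) (k n : nat).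

Definition block_set : set R := [set x | exists w : nat -> nat,
  (forall n, N n <= w n < N n + N n)%N /\ forall n, cylinder q (mkseq w n) x].

Lemma block_set_sub : block_set `<=` [set x : R | 0 <= x < 1].
Proof. by move=> x [w [_ /(_ 0%N)]]; rewrite /cylinder /= add0r. Qed.

Lemma size_wordsS n : size (words N n.+1) = (size (words N n) * N n)%N.
Proof. by rewrite size_allpairs size_iota. Qed.

Lemma mkseq_words w n : (forall n, N n <= w n < N n + N n)%N ->
  mkseq w n \in words N n.
Proof.
move=> wN; elim: n => // n IH; rewrite mkseqS /=.
by apply: allpairs_f => //; rewrite mem_iota.
Qed.

(** Both sides are multiplicative along a word, so the bound for single digits propagates. *)
Lemma cylinder_length_words a :
  (forall n k, (N n <= k < N n + N n)%N -> (N n)%:R^-1 <= q k `^ a) ->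
  forall n s, s \in words N n ->
    (size (words N n))%:R^-1 <= cylinder_length q s `^ a.
Proof.
move=> qN; elim=> [|n IH] s.
  by rewrite inE => /eqP ->; rewrite /cylinder_length big_nil powR1 invr1.
move=> /allpairsP[[p k] [/= pn kn ->]].
have L0 := ltW (cylinder_length_gt0 _ hq p); have qk0 := ltW (hq.1 k).
rewrite size_wordsS natrM invfM cylinder_length_rcons powRM//.
by rewrite ler_pM ?invr_ge0 ?ler0n ?IH ?qN// -mem_iota.
Qed.

(** * Escaping a cheap covering by cylinders *)

Section EscapingWord.
Variables (J : set nat) (s : nat -> seq nat) (g : nat -> \bar R).
Hypotheses (g_ge0 : forall j, (0 <= g j)%E).

(** With [s j] the word of the [j]-th covering cylinder and [g j] its cost, this is the cost spent
    within the cylinder of [p]. *)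
Let mass p := (\esum_(j in J `&` [set j | prefix p (s j)]) g j)%E.

(** After exchanging the sums, each [j] counts at most once, since [s j] extends at most one child
    of [p]. Equality can fail, for instance when [s j] is [p] itself. *)
Lemma sum_mass_rcons p (r : seq nat) : uniq r ->
  (\sum_(k <- r) mass (rcons p k) <= mass p)%E.
Proof.
move=> r_uniq; rewrite /mass esum_mkcond.
under eq_bigr do rewrite esum_mkcond.
rewrite -esum_sum; last by move=> i j _ _; case: ifP.
apply: le_esum => j _.
have rcons_nth k : j \in J `&` [set j | prefix (rcons p k) (s j)] ->
    j \in J `&` [set j | prefix p (s j)] /\ k = nth 0%N (s j) (size p).
  rewrite !inE => -[Jj /= /prefixP[t ->]]; rewrite cat_rcons; split.
    by split=> //=; exact: prefix_prefix.
  by rewrite nth_cat ltnn subnn.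
(* If [s j] is no longer than [p], then [k0] is the default 0; this is harmless, as no [rcons p k]
   is then a prefix of [s j]. *)
set k0 := nth 0%N (s j) (size p) in rcons_nth.
have off_k0 k : k != k0 ->
    (if j \in J `&` [set j | prefix (rcons p k) (s j)] then g j else 0%E) = 0%E.
  by move=> /eqP kk0; case: ifP => // /rcons_nth[].
have le_k0 : ((if j \in J `&` [set j | prefix (rcons p k0) (s j)] then g j else 0) <=
    (if j \in J `&` [set j | prefix p (s j)] then g j else 0))%E.
  by case: ifP => [/rcons_nth[-> _]//|_]; case: ifP.
have [k0r|k0r] := boolP (k0 \in r).
  rewrite (bigD1_seq k0)//= big1 ?adde0// => k; exact: off_k0.
rewrite big_seq big1; first by case: ifP.
by move=> k kr; apply: off_k0; apply: contraNneq k0r => <-.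
Qed.

(** Pigeonhole: [N n] children, each with at least its share, would together reach the share of
    [p]. *)
Lemma exists_light_child n p : (mass p < ((size (words N n))%:R^-1)%:E)%E ->
  exists2 k, (N n <= k < N n + N n)%N &
    (mass (rcons p k) < ((size (words N n.+1))%:R^-1)%:E)%E.
Proof.
move=> light; apply: contrapT => heavy; move: light; apply/negP; rewrite -leNgt.
apply: le_trans (sum_mass_rcons p _ (iota_uniq (N n) (N n))).
apply: (@le_trans _ _ (\sum_(k <- iota (N n) (N n)) ((size (words N n.+1))%:R^-1)%:E)%E).
  rewrite sumEFin lee_fin big_const_seq count_predT size_iota iter_addr_0.
  rewrite size_wordsS natrM invfM -[leRHS]mulr_natr -mulrA mulVf ?mulr1//.
  by rewrite pnatr_eq0 -lt0n N_gt0.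
rewrite big_seq [leRHS]big_seq; apply: lee_sum => k.
rewrite mem_iota leNgt => kN; apply/negP => light_k; apply: heavy.
by exists k.
Qed.

Lemma exists_escaping_word : (\esum_(j in J) g j < 1)%E ->
  exists2 w, (forall n, N n <= w n < N n + N n)%N &
    forall n, (mass (mkseq w n) < ((size (words N n))%:R^-1)%:E)%E.
Proof.
move=> J1.
(* The lightness of [p] is a premise inside the choice, so that [next] is total and can be iterated
   before lightness is known. *)
have /choice[next nextP] : forall p, exists k,
    (mass p < ((size (words N (size p)))%:R^-1)%:E)%E ->
    (N (size p) <= k < N (size p) + N (size p))%N /\
    (mass (rcons p k) < ((size (words N (size p).+1))%:R^-1)%:E)%E.
  move=> p; have [light|_] := boolP (_ < _)%E; last by exists 0%N.
  by have [k kN light_k] := exists_light_child _ _ light; exists k.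
pose prf := fix prf n := if n is m.+1 then rcons (prf m) (next (prf m)) else [::].
pose w n := next (prf n).
have prfE n : prf n = mkseq w n by elim: n => // n IH; rewrite mkseqS -IH.
have size_prf n : size (prf n) = n by rewrite prfE size_mkseq.
have light n : (mass (prf n) < ((size (words N n))%:R^-1)%:E)%E.
  elim: n => [|n IH].
    rewrite /= invr1; suff -> : mass [::] = (\esum_(j in J) g j)%E by exact: J1.
    congr esum; apply/seteqP; split => [j []//|j Jj].
    by split=> //=; rewrite prefix0s.
  by have := nextP (prf n); rewrite size_prf => /(_ IH)[].
exists w => n; last by rewrite -prfE.
by have := nextP (prf n); rewrite size_prf => /(_ (light n))[].
Qed.

End EscapingWord.

Lemma block_set_measure_eq0 a :
  (forall n, 1 - series q (N n) <= n.+1%:R^-1) ->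
  (forall n, (size (words N n))%:R * (1 - series q (N n)) `^ a <= n.+1%:R^-1) ->
  0 < a -> hausdorff_measure [set: set R] a block_set = 0%E.
Proof.
move=> tail_le sum_le a0; apply: hausdorff_measure_eq0 => eps eps0.
have [n /= n_eps] : exists n, n.+1%:R^-1 < eps :> R.
  by have [n _ nP] := near_infty_natSinv_lt (PosNum eps0); exists n; apply: nP => /=.
pose t := 1 - series q (N n).
have t0 : 0 < t by rewrite subr_gt0 series_lt1.
pose L (s : seq nat) := cylinder_length q s.
(* [C j] is the right end of the cylinder of [s], made of all its children with digit at least
   [N n]. *)
pose C j := let s := nth [::] (words N n) j in
  [set x | cylinder_left q s + L s * series q (N n) <= x <
     cylinder_left q s + L s * series q (N n) + L s * t].
have diamC j : (diam (C j) <= t%:E)%E.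
  rewrite /C; set s := nth _ _ _.
  have L0 : 0 < L s := cylinder_length_gt0 _ hq _.
  have L1 : L s <= 1 := cylinder_length_le1 _ hq _.
  apply: le_trans (diam_itvco_le _ _ _) _; first by rewrite mulr_ge0// ltW.
  by rewrite lee_fin ler_piMl// ltW.
pose J := `I_(size (words N n)).
apply: (@le_trans _ _ (\esum_(j in J) poweR (diam (C j)) a)%E).
  apply: ereal_inf_lbound; exists J, C; split=> //; split => // [j _|].
    apply: le_trans (diamC j) _; rewrite lee_fin.
    by apply: le_trans (tail_le n) (ltW n_eps).
  move=> x [w [wN wx]].
  have in_words : mkseq w n \in words N n by apply: mkseq_words.
  exists (index (mkseq w n) (words N n)); first by rewrite /J /= index_mem.
  rewrite /C nth_index//=.
  have := wx n.+1; rewrite mkseqS cylinderE /= => /andP[+ _].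
  rewrite cylinder_left_rcons; have := wx n; rewrite cylinderE /= => /andP[_].
  set s := mkseq w n; rewrite -/(L s) => xs sx.
  have L0 : 0 < L s := cylinder_length_gt0 _ hq _.
  apply/andP; split; last by rewrite /t mulrBr; lra.
  apply: le_trans sx; rewrite lerD2l ler_pM2l//.
  have /andP[Nw _] := wN n.
  by apply: nondecreasing_series Nw => i _ _; exact/ltW/hq.1.
rewrite esum_fset; [|exact: finite_II|by move=> *; exact: poweR_ge0].
rewrite -fsbig_ord; apply: (@le_trans _ _ (\sum_(i < size (words N n)) (t `^ a)%:E)%E).
  apply: lee_sum => i _; rewrite -poweR_EFin; apply: gt0_ler_poweR => //.
  - exact: ltW.
  - by rewrite in_itv /= diam_ge0 leey.
  - by rewrite in_itv /= lee_fin ltW//= leey.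
rewrite sumEFin lee_fin sumr_const card_ord -mulr_natl.
by apply: le_trans (sum_le n) (ltW n_eps).
Qed.

Lemma block_set_premeasure_ge1 a eps : 0 <= a ->
  (forall n s, s \in words N n ->
     (size (words N n))%:R^-1 <= cylinder_length q s `^ a) ->
  (1 <= hausdorff_premeasure (cylinders q) a block_set eps)%E.
Proof.
move=> a0 length_ge; apply/ereal_infP => _ [J [C [[JC _ EC] ->]]].
have /choice[s sE] : forall j, exists s, J j -> C j = cylinder q s.
  move=> j; have [/JC[s _ ->]|nJ] := pselect (J j); first by exists s.
  by exists [::].
rewrite leNgt; apply/negP => /(exists_escaping_word _ s).
case=> [j|w wN light]; first exact: poweR_ge0.
have [x wx] := bigcap_cylinder_neq0 _ hq w.
have [j Jj Cx] : (\bigcup_(j in J) C j) x by apply: EC; exists w.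
have sjE : s j = mkseq w (size (s j)).
  have := cylinder_prefix _ hq (s j) (mkseq w (size (s j))) x.
  rewrite size_mkseq leqnn -sE// => /(_ isT Cx (wx _)).
  by rewrite prefixE take_oversize ?size_mkseq// => /eqP.
set n := size (s j) in sjE.
(* The cylinder [s j] containing [x] is one of those along [w]; its cost alone is already the full
   share that [light] forbids. *)
have := light n; rewrite ltNge => /negP; apply.
apply: esum_ge; exists [set j].
  by split=> // _ ->; split=> //=; rewrite sjE; exact: prefix_refl.
rewrite fsbig_set1.
apply: (@le_trans _ _ (poweR (cylinder_length q (s j))%:E a)).
  by rewrite poweR_EFin lee_fin length_ge// sjE; exact: mkseq_words.
have L0 := cylinder_length_gt0 _ hq (s j).
apply: gt0_ler_poweR => //.
- by rewrite in_itv /= lee_fin ltW//= leey.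
- by rewrite in_itv /= diam_ge0 leey.
- by rewrite sE//; exact: diam_cylinder_ge.
Qed.

End DigitBlocks.

(** * Choice of the block sizes *)

Section BlockSizes.
Context {R : realType} (q : nat -> R) (m0 A : R).
Hypotheses (hq : stochastic_vector q) (hm0 : 1 < m0) (hA : 0 < A).
Hypothesis q_ge : forall i : nat, (0 < i)%N -> A / (i%:R `^ m0) <= q i.

Lemma near_tail_le (d : R) : 0 < d -> \forall n \near \oo, 1 - series q n <= d.
Proof.
move=> d0; have /cvgrPdist_le/(_ d d0) := hq.2.
by apply: filterS => n; apply: le_trans; exact: ler_norm.
Qed.

(** The exponent [1 / (2 m0)] turns [A / k^m0] into [c / sqrt k]. For [k < 2 n] this is at least
    [1 / n] once [2 n <= (c n)^2], that is, [n >= 2 / c^2]. *)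
Lemma near_digit_weight : \forall n \near \oo,
  forall k, (n <= k < n + n)%N -> n%:R^-1 <= q k `^ (2 * m0)^-1.
Proof.
pose c := A `^ (2 * m0)^-1.
have c0 : 0 < c by rewrite powR_gt0.
near=> n => k /andP[nk kn].
have n0 : (0 < n)%N by near: n; exact: nbhs_infty_gt.
have n0R : 0 < n%:R :> R by rewrite ltr0n.
have k0 : (0 < k)%N := leq_trans n0 nk.
have k0R : 0 < k%:R :> R by rewrite ltr0n.
have cn : 2 / c ^+ 2 <= n%:R by near: n; exact: nbhs_infty_ger.
have sqrt_k : Num.sqrt k%:R <= c * n%:R.
  have cn0 : 0 <= c * n%:R by rewrite mulr_ge0// ltW.
  rewrite -[leRHS]ger0_norm// -sqrtr_sqr ler_sqrt ?exprn_ge0//.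
  apply: (@le_trans _ _ (2 * n%:R)).
    by rewrite -natrM ler_nat mul2n -addnn ltnW.
  rewrite exprMn [n%:R ^+ 2]expr2 mulrA ler_pM2r// mulrC.
  by rewrite -ler_pdivrMr ?exprn_gt0.
have q_c : c / Num.sqrt k%:R <= q k `^ (2 * m0)^-1.
  have -> : c / Num.sqrt k%:R = (A / k%:R `^ m0) `^ (2 * m0)^-1.
    rewrite powRM ?invr_ge0 ?powR_ge0 ?(ltW hA)//; congr (_ * _).
    rewrite -powRN -powRrM mulNr powRN invfM mulrCA mulfV ?mulr1;
      last by rewrite gt_eqF// (lt_trans ltr01).
    by rewrite powR12_sqrt ?ler0n.
  have a0 : 0 <= (2 * m0)^-1 by rewrite invr_ge0 mulr_ge0// ltW// (lt_trans ltr01).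
  by apply: ge0_ler_powR (q_ge _ k0); rewrite // nnegrE ?divr_ge0 ?powR_ge0 ?ltW// hq.1.
apply: le_trans q_c; rewrite ler_pdivlMr ?sqrtr_gt0//.
by rewrite mulrC ler_pdivrMr.
Unshelve. all: by end_near. Qed.

Lemma exists_block_sizes (a : R) : 0 < a -> exists N : nat -> nat,
  [/\ forall n, (0 < N n)%N,
      forall n, 1 - series q (N n) <= n.+1%:R^-1,
      forall n, (size (words N n))%:R * (1 - series q (N n)) `^ a <= n.+1%:R^-1
    & forall n k, (N n <= k < N n + N n)%N ->
        (N n)%:R^-1 <= q k `^ (2 * m0)^-1].
Proof.
move=> a0.
(* The conditions on [N m] involve earlier block sizes only through the number [P] of admissible
   words of length [m], so a choice for every pair [(m, P)] permits the recursion. *)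
have /choice[G GP] : forall mP : nat * nat, exists n : nat,
    [/\ (0 < n)%N, 1 - series q n <= mP.1.+1%:R^-1,
      mP.2%:R * (1 - series q n) `^ a <= mP.1.+1%:R^-1
    & forall k, (n <= k < n + n)%N -> n%:R^-1 <= q k `^ (2 * m0)^-1].
  (* [d] solves [(P + 1) d^a = 1 / (m + 1)]; [P + 1] keeps the divisor nonzero. *)
  move=> [m P] /=; pose d : R := (m.+1%:R^-1 / P.+1%:R) `^ a^-1.
  have d0 : 0 < d by rewrite powR_gt0 ?divr_gt0 ?invr_gt0 ?ltr0n.
  suff : \forall n \near \oo, [/\ (0 < n)%N, 1 - series q n <= m.+1%:R^-1,
      P%:R * (1 - series q n) `^ a <= m.+1%:R^-1
    & forall k, (n <= k < n + n)%N -> n%:R^-1 <= q k `^ (2 * m0)^-1].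
    by case=> n _ /(_ n (leqnn n)) nP; exists n.
  near=> n; split.
  - by near: n; exact: nbhs_infty_gt.
  - by near: n; apply: near_tail_le; rewrite invr_gt0 ltr0n.
  - have t0 : 0 <= 1 - series q n by rewrite subr_ge0 ltW// series_lt1.
    have : (1 - series q n) `^ a <= d `^ a.
      apply: ge0_ler_powR; rewrite ?nnegrE ?(ltW a0) ?(ltW d0)//.
      by near: n; exact: near_tail_le.
    rewrite -powRrM mulVf ?gt_eqF// powRr1 ?divr_ge0 ?invr_ge0 ?ler0n//.
    rewrite ler_pdivlMr ?ltr0n// mulrC; apply: le_trans.
    by rewrite ler_wpM2r ?powR_ge0// ler_nat.
  - by near: n; exact: near_digit_weight.
pose P := fix P n := if n is m.+1 then (P m * G (m, P m))%N else 1%N.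
pose N n := G (n, P n).
have size_wordsE n : size (words N n) = P n.
  by elim: n => // n IH; rewrite size_wordsS IH.
by exists N; split=> n; rewrite ?size_wordsE; case: (GP (n, P n)).
Unshelve. all: by end_near. Qed.

End BlockSizes.

Theorem theorem2 (R : realType) (q : nat -> R) (m0 A B : R)
    (hq : stochastic_vector q) (hm0 : 1 < m0) (hA : 0 < A) (hB : 0 < B)
    (hAB : forall i : nat, (0 < i)%N ->
       A / (i%:R `^ m0) <= q i <= B / (i%:R `^ m0)) :
  exists E : set R, E `<=` [set x : R | 0 <= x < 1] /\
    hausdorff_dim_wrt E (cylinders q) <> hausdorff_dim E.
Proof.
pose a : R := (2 * m0)^-1.
have a0 : 0 < a by rewrite invr_gt0; lra.
have a20 : 0 < a / 2 by rewrite divr_gt0.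
have q_ge i : (0 < i)%N -> A / (i%:R `^ m0) <= q i by move=> /hAB/andP[].
(* The tails are made small for the exponent [a / 2], strictly below the lower bound [a] for the
   cylinder dimension. *)
have [N [N0 tail_le sum_le qN]] := exists_block_sizes q m0 A hq hm0 hA q_ge _ a20.
exists (block_set q N); split; first exact: block_set_sub.
have le_dim : (a%:E <= hausdorff_dim_wrt (block_set q N) (cylinders q))%E.
  apply: hausdorff_dim_wrt_ge => b b0 ba.
  apply: lt_le_trans lte01 _; apply: hausdorff_measure_ge => eps _.
  apply: block_set_premeasure_ge1 => // n s sn.
  apply: le_trans (cylinder_length_words _ _ hq _ qN _ _ sn) _.
  (* Lengths are at most 1, so lowering the exponent from [a] to [b] only raises the cost. *)
  by apply: ger_powR => //; rewrite cylinder_length_gt0//= cylinder_length_le1.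
have dim_le : (hausdorff_dim (block_set q N) <= (a / 2)%:E)%E.
  apply: hausdorff_dim_wrt_le; first exact: ltW.
  exact: block_set_measure_eq0.
move=> dimE; have := le_trans le_dim _; rewrite dimE => /(_ _ dim_le).
by rewrite lee_fin; lra.
Qed.
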